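(* Let $\mathcal{A}$ be a finite alphabet, let $T=\mathcal{A}^{<\mathbb{N}}$ be the full tree, and fix a strategy $s_1$ of Player 1 in $T$. For any set $C\subseteq\mathcal{A}^{<\mathbb{N}}$ let $$Z_{s_1}(C)=\bigl\{\langle a_1,c_1,a_2,c_2,\dots,a_n,c_n\rangle:\ \langle c_1,\dots,c_n\rangle\in C,\ a_1,\dots,a_n\in\mathcal{A}\ \text{are the actions prescribed to Player 1 by } s_1\bigr\},$$ that is, $a_i=s_1(\langle a_1,c_1,\dots,a_{i-1},c_{i-1}\rangle)$ for $1\le i\le n$. Then a set $C$ is a maximal prefix code if and only if the following two conditions hold: 1. $Z_{s_1}(C)$ is a minimal-size set; and 2. the strategy $s_1$ is (the only) winning strategy for Player 1 in the game $(T,W)$, where $W=\bigcup_{p\in Z_{s_1}(C)}[T_p]$.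
   Context: $\mathcal{A}^{<\mathbb{N}}$ is the set of all finite sequences over $\mathcal{A}$ (including the empty sequence); its elements are called positions, and $\mathrm{len}(p)$ is the length of $p$. A play is an infinite sequence in $\mathcal{A}^{\mathbb{N}}$; $[T]=\mathcal{A}^{\mathbb{N}}$ is the set of plays, and for $p\in T$, $[T_p]$ is the set of plays having $p$ as a prefix. In the game $(T,W)$ with $W\subseteq[T]$, two players alternately choose actions in $\mathcal{A}$, with Player 1 moving at positions of even length (in particular first) and Player 2 at positions of odd length, each knowing all previous moves; Player 1 wins if the resulting play lies in $W$, and otherwise Player 2 wins. A strategy of Player 1 is a function assigning an action to every position of even length; it is winning if every play consistent with it lies in $W$. A set $Z$ of positions is minimal-size if $\sum_{p\in Z}|\mathcal{A}|^{-\lfloor \mathrm{len}(p)/2\rfloor}=1$. A prefix code over $\mathcal{A}$ is a set of finite sequences over $\mathcal{A}$ none of which is a prefix of another; it is maximal if there is no prefix code over $\mathcal{A}$ strictly containing it.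
   Formalization: ''C is a maximal prefix code'' is replaced by ''C is a finite maximal prefix code'' (for infinite C, e.g. {0^n 1}, the claim fails), and ''the only winning strategy'' means unique at positions consistent with s_1 where the play is not yet bound to lie in W. *)

(* Defs.v *)
From mathcomp Require Export all_boot all_order all_algebra.
From mathcomp Require Export boolp classical_sets cardinality reals ereal esum.

Set Implicit Arguments.
Unset Strict Implicit.
Unset Printing Implicit Defensive.

Local Open Scope classical_set_scope.
Local Open Scope ring_scope.

(* Only the values at positions of even length matter: every definition below
   evaluates a strategy of Player 1 at such positions only. *)
Definition strategy1 (A : finType) := seq A -> A.

Definition play (A : finType) := nat -> A.

Definition cylinder (A : finType) (p : seq A) : set (play A) :=
  [set w | mkseq w (size p) = p].

Definition consistent_play (A : finType) (s : strategy1 A) : set (play A) :=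
  [set w | forall k, w k.*2 = s (mkseq w k.*2)].

Definition consistent_pos (A : finType) (s : strategy1 A) : set (seq A) :=
  [set p | forall k, (k.*2 < size p)%N -> onth p k.*2 = Some (s (take k.*2 p))].

Definition winning (A : finType) (s : strategy1 A) (W : set (play A)) :=
  consistent_play s `<=` W.

(* A strategy also prescribes actions at positions it never reaches and at
   positions where the play is already bound to lie in W; these actions have no
   effect, so uniqueness of a winning strategy is understood up to them. *)
Definition only_winning (A : finType) (s : strategy1 A) (W : set (play A)) :=
  winning s W /\
  forall s' : strategy1 A, winning s' W ->
    forall p : seq A, ~~ odd (size p) -> consistent_pos s p ->
      ~ (cylinder p `<=` W) -> s' p = s p.

(* The position <a_1, c_1, ..., a_n, c_n> obtained when Player 2 plays
   c = <c_1, ..., c_n> against s. *)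
Definition respond (A : finType) (s : strategy1 A) (c : seq A) : seq A :=
  foldl (fun p x => p ++ [:: s p; x]) [::] c.

Definition Z_of (A : finType) (s : strategy1 A) (C : set (seq A)) :
    set (seq A) :=
  [set respond s c | c in C].

Definition win_set (A : finType) (Z : set (seq A)) : set (play A) :=
  \bigcup_(p in Z) cylinder p.

Definition minimal_size (R : realType) (A : finType) (Z : set (seq A)) :=
  \esum_(p in Z) ((#|A|%:R ^- (size p)./2 : R)%:E) = 1%E.

Definition prefix_code (A : finType) (C : set (seq A)) :=
  forall p q, C p -> C q -> prefix p q -> p = q.

Definition maximal_prefix_code (A : finType) (C : set (seq A)) :=
  prefix_code C /\ forall D, prefix_code D -> ~ (C `<` D).

(* Main.v *)
(* Let m = #|A|.  A strategy of Player 1 turns the words c over A into the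
   even-length positions consistent with it, and the infinite words into the
   consistent plays.  Hence the strategy wins iff C is a bar (every infinite word
   has a prefix in C), and Z is minimal-size iff the Kraft sum of m^-|c| over C
   is 1.  A finite maximal prefix code is a bar in which every long word has
   exactly one prefix, so counting long words gives Kraft sum 1.  Conversely, by
   Koenig's lemma a bar contains a finite set with Kraft sum at least 1; as all
   weights are positive, a bar with Kraft sum 1 equals any such subset, so it is
   finite, and it is a prefix code since a proper extension of one of its words
   could be dropped.  Uniqueness of the strategy is automatic: a strategy
   deviating at a position where the play is still undecided yields a play that
   has no prefix in Z. *)
Require Import Defs.
From mathcomp Require Import fsbigop.

Set Implicit Arguments.
Unset Strict Implicit.
Unset Printing Implicit Defensive.

Import Order.TTheory GRing.Theory Num.Theory.

Local Open Scope classical_set_scope.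

(** * Prefix codes, bars and compactness *)

Section Bars.
Variable A : finType.
Implicit Types (c p q w : seq A) (v : nat -> A) (C S : set (seq A)).

Definition bar C := forall v, exists n, C (mkseq v n).

Lemma take_mkseq v m n : (m <= n)%N -> take m (mkseq v n) = mkseq v m.
Proof.
by move=> mn; rewrite /mkseq -map_take take_iota; congr (map _ (iota _ _)); apply/minn_idPl.
Qed.

Lemma prefix_mkseq v p n : prefix p (mkseq v n) -> p = mkseq v (size p).
Proof.
move=> pv; have := size_prefix pv; rewrite size_mkseq => pn.
by move: pv; rewrite prefixE take_mkseq// => /eqP.
Qed.

Lemma prefix_total p q w : prefix p w -> prefix q w -> prefix p q || prefix q p.
Proof.
wlog le_pq : p q / (size p <= size q)%N.
  move=> H; case: (leqP (size p) (size q)) => [|/ltnW] le_pq pw qw; first exact: H.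
  by rewrite orbC; apply: H.
rewrite !prefixE => /eqP pw /eqP qw; apply/orP; left.
by rewrite -qw take_takel// pw.
Qed.

(** Otherwise [w] could be added to [C]. *)
Lemma maximal_prefix_codeP C w : maximal_prefix_code C ->
  exists2 c, C c & prefix c w || prefix w c.
Proof.
move=> [Cpre Cmax]; apply: contrapT => Nw.
have {}Nw c : C c -> ~~ (prefix c w || prefix w c).
  by move=> Cc; apply/negP => cw; apply: Nw; exists c.
apply: (Cmax (w |` C)).
  move=> p q [->|Cp] [->|Cq] // pq.
  - by move: (Nw _ Cq); rewrite pq orbT.
  - by move: (Nw _ Cp); rewrite pq.
  - exact: Cpre.
split; first by right.
by move=> /(_ w (or_introl erefl)) /Nw; rewrite prefix_refl.
Qed.

Lemma finite_set_size_bound C : finite_set C ->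
  exists n, forall c, C c -> (size c <= n)%N.
Proof.
move=> /finite_seqP[s ->]; exists (\max_(c <- s) size c)%N => c /= cs.
by rewrite (big_rem c)//= leq_maxl.
Qed.

Lemma maximal_prefix_code_bar C : finite_set C -> maximal_prefix_code C -> bar C.
Proof.
move=> /finite_set_size_bound[n Cn] Cmax v.
have [c Cc] := maximal_prefix_codeP (mkseq v n) Cmax.
case/orP => [/prefix_mkseq cv|vc]; first by exists (size c); rewrite -cv.
(* Since [n] bounds all code words, one that extends [mkseq v n] equals it. *)
exists n; move: (vc); rewrite prefixE size_mkseq => /eqP <-.
by rewrite take_oversize//; exact: Cn.
Qed.

(* Koenig's lemma for bars: from a word none of whose extension lengths is
   uniformly barred one can always choose a next letter with the same property. *)
Lemma bar_uniform C : bar C ->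
  exists n, forall w, (n <= size w)%N -> exists2 c, C c & prefix c w.
Proof.
move=> barC; pose U x :=
  exists n, forall w, (n <= size w)%N -> exists2 c, C c & prefix c (x ++ w).
suff : U [::] by [].
apply: contrapT => NU0.
have step x : ~ U x -> exists a, ~ U (rcons x a).
  move=> NUx; apply: contrapT => /forallNP/= Ua; apply: NUx.
  have {Ua}/choice[f fP] : forall a, exists n, forall w, (n <= size w)%N ->
      exists2 c, C c & prefix c (rcons x a ++ w).
    by move=> a; have /contrapT := Ua a.
  exists (\max_(a : A) f a).+1 => -[//|a w] /=; rewrite ltnS => lew.
  rewrite -cat_rcons; apply: fP; apply: leq_trans lew.
  exact: leq_bigmax.
(* [A] is not assumed inhabited here; the root yields a default letter for [g] where [U] holds. *)
have [a0 _] := step _ NU0.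
have {step}/choice[g gP] : forall x, exists a, ~ U x -> ~ U (rcons x a).
  move=> x; have [Ux|/step[a Na]] := pselect (U x); last by exists a.
  by exists a0.
pose x n := iter n (fun y => rcons y (g y)) [::].
have NU n : ~ U (x n) by elim: n => //= n /gP.
pose v n := g (x n).
have xE n : x n = mkseq v n by elim: n => // n IH; rewrite mkseqS -IH.
have [n Cn] := barC v; apply: (NU n); exists 0%N => w _.
by exists (x n); rewrite ?xE// prefix_prefix.
Qed.

End Bars.

(** * Kraft sums *)

Section Kraft.
Variables (R : realType) (A : finType) (a0 : A).
Implicit Types (c p q w : seq A) (C S : set (seq A)) (s : seq (seq A)).
Local Notation weight c := ((#|A|%:R ^- size c : R)%R).
Local Notation kraft C := (esum C (fun c => (weight c)%:E)).

Let card_gt0 : (0 < #|A|)%N. Proof. by apply/card_gt0P; exists a0. Qed.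

Fixpoint words n : seq (seq A) :=
  if n is n'.+1 then [seq a :: w | a <- enum A, w <- words n'] else [:: [::]].

Lemma size_words n : size (words n) = (#|A| ^ n)%N.
Proof. by elim: n => //= n IH; rewrite size_allpairs IH -cardE expnS. Qed.

Lemma mem_words n w : w \in words n -> size w = n.
Proof.
elim: n w => [|n IH] w /=; first by rewrite inE => /eqP ->.
by move=> /allpairsP[[a u] /= [_ /IH <- ->]].
Qed.

Lemma sum_prefix_words c n : (size c <= n)%N ->
  (\sum_(w <- words n) prefix c w = #|A| ^ (n - size c))%N.
Proof.
elim: c n => [|a c IH] n.
  move=> _; rewrite subn0 -size_words -sum1_size.
  by apply: eq_bigr => w _; rewrite prefix0s.
case: n => //= n lecn; rewrite big_allpairs_dep/= big_enum/= (bigD1 a)//=.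
rewrite [X in (_ + X)%N]big1 ?addn0; last first.
  by move=> b /negPf ba; apply: big1 => w _; rewrite eq_sym ba.
by rewrite subSS -IH//; apply: eq_bigr => w _; rewrite eqxx.
Qed.

(** Double counting of the pairs of [c] in [s] and [w] of length [n] with [c] a prefix of [w]. *)
Lemma kraft_count s n : (forall c, c \in s -> (size c <= n)%N) ->
  (\sum_(c <- s) weight c =
   (\sum_(w <- words n) count (fun c => prefix c w) s)%:R / #|A|%:R ^+ n)%R.
Proof.
move=> sn; have m0 : (#|A|%:R != 0 :> R)%R by rewrite pnatr_eq0 -lt0n.
rewrite (eq_bigr (fun w => \sum_(c <- s) prefix c w)%N); last first.
  by move=> w _; rewrite -sum1_count big_mkcond/=; apply: eq_bigr => c _; case: ifP.
rewrite exchange_big/= natr_sum mulr_suml !big_seq; apply: eq_bigr => c cs.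
rewrite sum_prefix_words ?sn// natrX -[in X in (_ / X)%R](subnK (sn _ cs)) exprD.
by rewrite invfM mulrA mulfV ?mul1r// expf_neq0.
Qed.

Lemma kraft_ge1 s n : (forall c, c \in s -> (size c <= n)%N) ->
  (forall w, size w = n -> has (fun c => prefix c w) s) ->
  (1 <= \sum_(c <- s) weight c)%R.
Proof.
move=> sn sw; rewrite (kraft_count sn) ler_pdivlMr ?exprn_gt0 ?ltr0n// mul1r.
rewrite -natrX ler_nat -size_words -sum1_size !big_seq.
by apply: leq_sum => w /mem_words /sw; rewrite has_count.
Qed.

Lemma kraft_eq1 s n : uniq s -> prefix_code [set` s] ->
  (forall c, c \in s -> (size c <= n)%N) ->
  (forall w, size w = n -> has (fun c => prefix c w) s) ->
  (\sum_(c <- s) weight c = 1)%R.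
Proof.
move=> us pre sn sw; rewrite (kraft_count sn).
rewrite big_seq (eq_bigr (fun=> 1%N)) => [|w /mem_words /sw /hasP[c cs cw]].
  rewrite -big_seq sum1_size size_words natrX divff//.
  by rewrite expf_neq0// pnatr_eq0 -lt0n.
(* Two prefixes of [w] are comparable, so the code contains no prefix of [w] other than [c]. *)
transitivity (nat_of_bool (c \in s)); last by rewrite cs.
rewrite -count_uniq_mem//; apply: eq_in_count => d ds /=.
apply/idP/eqP => [dw|->//].
have /orP[/pre|/pre] := prefix_total dw cw; first exact.
by move=> H; apply/esym/H.
Qed.

Lemma esum_weight_seq s : uniq s ->
  kraft [set` s] = ((\sum_(c <- s) weight c)%R%:E)%E.
Proof.
move=> us; rewrite esum_fset//; last exact: finite_seq.
by rewrite -fsbig_seq// sumEFin.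
Qed.

(** One prefix in [C] is chosen for each word of the uniform length [n]. *)
Lemma bar_finite_kraft C : bar C -> exists s, [/\ uniq s,
  [set` s] `<=` C & (1%E <= kraft [set` s])%E].
Proof.
move=> /bar_uniform[n nC].
have {nC}/choice[f fP] : forall w, exists c, size w = n -> C c /\ prefix c w.
  move=> w; have [wn|] := eqVneq (size w) n; last by move=> /eqP; exists [::].
  by have [|c ? ?] := nC w; [rewrite wn | exists c].
exists (undup [seq f w | w <- words n]); split; first exact: undup_uniq.
  by move=> c /=; rewrite mem_undup => /mapP[w /mem_words /fP[Cw _] ->].
rewrite esum_weight_seq ?undup_uniq// lee_fin; apply: (@kraft_ge1 _ n).
  move=> c; rewrite mem_undup => /mapP[w /mem_words wn ->].
  by rewrite -wn; apply: size_prefix; have [] := fP _ wn.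
move=> w wn; apply/hasP; exists (f w); last by have [] := fP _ wn.
rewrite mem_undup; apply: map_f.
elim: w n wn {fP} => [|a w IH] [|n] //= [wn].
by apply/allpairsP; exists (a, w); rewrite mem_enum; split => //; exact: IH.
Qed.

Lemma bar_kraft_ge1 C : bar C -> (1%E <= kraft C)%E.
Proof.
move=> /bar_finite_kraft[s [_ sC s1]]; apply: (le_trans s1).
by rewrite (esumID [set` s] C)// (setIidr sC) leeDl// esum_ge0.
Qed.

(** A word of [C] outside [S] would add positive weight to a sum that is already at least 1. *)
Lemma kraft_tight C S : S `<=` C -> (1%E <= kraft S)%E ->
  kraft C = 1%E -> C `<=` S.
Proof.
move=> SC S1 C1 x Cx; apply: contrapT => NSx.
suff : (1%E < kraft C)%E by rewrite C1 ltxx.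
rewrite (esumID S)// (setIidr SC) -[X in (X < _)%E]adde0.
apply: lee_ltD => //.
apply: (@lt_le_trans _ _ (weight x)%:E).
  by rewrite lte_fin invr_gt0 exprn_gt0// ltr0n.
rewrite (esumID [set x])// (_ : _ `&` [set x] = [set x]).
  by rewrite esum_set1// leeDl// esum_ge0.
by apply/setIidr => _ ->.
Qed.

Lemma finite_maximal_prefix_codeP C :
  (finite_set C /\ maximal_prefix_code C) <->
  (kraft C = 1%E /\ bar C).
Proof.
split=> [[finC Cmax]|[C1 barC]].
  split; last exact: maximal_prefix_code_bar.
  have [n Cn] := finite_set_size_bound finC.
  case/finite_seqP: finC => s0 CE.
  have {CE} : C = [set` undup s0] by rewrite CE; apply/seteqP; split => x /=; rewrite mem_undup.
  move: (undup s0) (undup_uniq s0) => s us CE.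
  rewrite CE esum_weight_seq// (@kraft_eq1 s n)//; rewrite -?CE.
  - by case: Cmax.
  - by move=> c cs; apply: Cn; rewrite CE.
  - move=> w wn; have [c Cc cw] := maximal_prefix_codeP w Cmax.
    apply/hasP; exists c; first by move: Cc; rewrite CE.
    case/orP: cw => //; rewrite prefixE wn take_oversize ?Cn// => /eqP ->.
    exact: prefix_refl.
have [s [us sC s1]] := bar_finite_kraft barC.
split; first by apply: sub_finite_set (finite_seq s); exact: kraft_tight.
have preC : prefix_code C.
  move=> p q Cp Cq pq; apply: contrapT => Npq.
  suff /(_ q Cq)[_] : C `<=` C `\ q by exact.
  apply: (kraft_tight _ _ C1); first by move=> x [].
  apply: bar_kraft_ge1 => v; have [n Cn] := barC v.
  (* An infinite word that meets [C] in [q] also meets it in the shorter word [p]. *)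
  have [vq|Nvq] := pselect (mkseq v n = q); last by exists n.
  exists (size p); rewrite -(@prefix_mkseq _ v p n) ?vq//.
split=> // D preD [CD NDC]; apply: NDC => x Dx.
(* Padding [x] to an infinite word gives a word of [C] comparable with [x]; as both lie in [D], they
   coincide. *)
pose v := nth a0 x.
have xE : x = mkseq v (size x) by rewrite mkseq_nth.
have [n Cn] := barC v.
have vx : prefix (mkseq v n) x || prefix x (mkseq v n).
  rewrite {1 2}xE; case: (leqP n (size x)) => [le|/ltnW le]; apply/orP; [left|right];
    by rewrite prefixE size_mkseq take_mkseq.
suff <- : mkseq v n = x by [].
have Dn := CD _ Cn.
by case/orP: vx => /preD => [|H]; [exact|apply/esym/H].
Qed.

End Kraft.

(** * Strategies, consistent plays and uniqueness *)

Section Games.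
Variable A : finType.
Implicit Types (s : strategy1 A) (c d p : seq A) (v w : nat -> A) (C : set (seq A)).

Lemma respond_rcons s c x :
  respond s (rcons c x) = respond s c ++ [:: s (respond s c); x].
Proof. by rewrite /respond foldl_rcons. Qed.

Lemma size_respond s c : size (respond s c) = (size c).*2.
Proof.
elim/last_ind: c => // c x IH.
by rewrite respond_rcons size_cat IH size_rcons doubleS addn2.
Qed.

(** Player 2's moves can be read off the odd indices, whatever the strategy; two strategies are
    allowed so that a deviation can be compared with [s]. *)
Lemma respond_inj2 s s' c d : respond s c = respond s' d -> c = d.
Proof.
elim/last_ind: c d => [|c x IH] d.
  by case/lastP: d => // d y /(congr1 size); rewrite !size_respond size_rcons.
case/lastP: d => [|d y] E.
  by move/(congr1 size): E; rewrite !size_respond size_rcons.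
have scd : size (respond s c) = size (respond s' d).
  by move/(congr1 size): E; rewrite !size_respond !size_rcons => /double_inj[->].
by move: E; rewrite !respond_rcons => /eqP; rewrite eqseq_cat// => /andP[/eqP /IH -> /eqP[_ ->]].
Qed.

Lemma respond_cat s c d : exists e, respond s (c ++ d) = respond s c ++ e.
Proof.
elim/last_ind: d => [|d x [e IH]]; first by exists [::]; rewrite !cats0.
rewrite -rcons_cat respond_rcons IH -catA.
by eexists; reflexivity.
Qed.

Lemma respond_cat_cons s c x d :
  exists e, respond s (c ++ x :: d) = respond s c ++ s (respond s c) :: e.
Proof.
rewrite -cat_rcons; have [e ->] := respond_cat s (rcons c x) d.
by rewrite respond_rcons -catA /=; eexists; reflexivity.
Qed.

Lemma consistent_posP s p : ~~ odd (size p) -> consistent_pos s p ->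
  exists c, p = respond s c.
Proof.
move=> /even_halfK; move: (size p)./2 => n pn consp.
have : (n.*2 <= size p)%N by rewrite pn.
suff H : (n.*2 <= size p)%N -> exists c, take n.*2 p = respond s c.
  by move=> /H[c]; rewrite pn take_size => ->; exists c.
elim: n {pn} => [_|n IH]; first by exists [::]; rewrite take0.
rewrite doubleS => lt2; have lt1 := ltnW lt2.
have [c cE] := IH (ltnW lt1).
have E : nth (s [::]) p n.*2 = s (take n.*2 p) by apply: onth_nth; exact: consp.
exists (rcons c (nth (s [::]) p n.*2.+1)).
rewrite respond_rcons -cE (take_nth (s [::]) lt2) (take_nth (s [::]) lt1) E.
by rewrite -!cats1 -catA.
Qed.

Definition respond_play s v : nat -> A :=
  fun i => if odd i then v i./2 else s (respond s (mkseq v i./2)).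

Lemma mkseq_respond_play s v n :
  mkseq (respond_play s v) n.*2 = respond s (mkseq v n).
Proof.
elim: n => // n IH; rewrite doubleS !mkseqS respond_rcons IH /respond_play /=.
by rewrite odd_double /= uphalf_double doubleK -!cats1 -catA.
Qed.

Lemma respond_play_consistent s v : consistent_play s (respond_play s v).
Proof.
by move=> k; rewrite mkseq_respond_play /respond_play odd_double doubleK.
Qed.

Lemma consistent_play_respond s w n : consistent_play s w ->
  mkseq w n.*2 = respond s (mkseq (fun i => w i.*2.+1) n).
Proof.
move=> sw; elim: n => // n IH; rewrite doubleS !mkseqS respond_rcons -IH.
by rewrite (sw n) -!cats1 -catA.
Qed.

Lemma winning_barP s C : winning s (win_set (Z_of s C)) <-> bar C.
Proof.
split=> [win v|barC w sw].
  have [_ [c Cc <-]] := win _ (respond_play_consistent s v).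
  rewrite /cylinder/= size_respond mkseq_respond_play => /respond_inj2 E.
  by exists (size c); rewrite E.
have [n Cn] := barC (fun i => w i.*2.+1).
exists (respond s (mkseq (fun i => w i.*2.+1) n)).
  by exists (mkseq (fun i => w i.*2.+1) n).
by rewrite /cylinder/= size_respond size_mkseq (consistent_play_respond _ sw).
Qed.

Lemma cylinder_cat p q : cylinder (p ++ q) `<=` cylinder p.
Proof.
move=> w; rewrite /cylinder/= size_cat => /(congr1 (take (size p))).
by rewrite take_size_cat// take_mkseq// leq_addr.
Qed.

(* The play in which Player 2 answers [c] and then arbitrarily against [s']
   must pass through [Z_of s C] strictly after [respond s c], where a deviation
   from [s] is visible. *)
Lemma winning_undecided s s' C c : winning s' (win_set (Z_of s C)) ->
  ~ (cylinder (respond s c) `<=` win_set (Z_of s C)) ->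
  respond s' c = respond s c -> s' (respond s c) = s (respond s c).
Proof.
move=> win Nc E; pose v := nth (s [::]) c.
have [_ [d Cd <-]] := win _ (respond_play_consistent s' v).
rewrite /cylinder/= size_respond mkseq_respond_play => dE.
have {}dv := respond_inj2 dE; rewrite dv in dE.
(* If [d] is no longer than [c], it is a prefix of [c] and the position is already decided. *)
have [le|lt] := leqP (size d) (size c).
  exfalso; apply: Nc.
  have dtake : take (size d) c = d by rewrite -[in RHS]dv -(take_mkseq v le) mkseq_nth.
  have -> : c = d ++ drop (size d) c by rewrite -[LHS](cat_take_drop (size d)) dtake.
  have [e ->] := respond_cat s d (drop (size d) c).
  by move=> w /cylinder_cat dw; exists (respond s d) => //; exists d.
have [x [e dc]] : exists x e, d = c ++ x :: e.
  have dtake : take (size c) d = c by rewrite -dv take_mkseq ?(ltnW lt)// mkseq_nth.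
  exists (nth (s [::]) d (size c)), (drop (size c).+1 d).
  by rewrite -drop_nth// -[LHS](cat_take_drop (size c)) dtake.
move: dE; rewrite dc.
have [e1 ->] := respond_cat_cons s' c x e; have [e2 ->] := respond_cat_cons s c x e.
by rewrite E => /eqP; rewrite eqseq_cat// eqxx => /= /eqP[].
Qed.

Lemma only_winningP s C :
  only_winning s (win_set (Z_of s C)) <-> winning s (win_set (Z_of s C)).
Proof.
split=> [[]//|win]; split=> // s' win' p evp /(consistent_posP evp)[c ->{p evp}] Nc.
apply: (winning_undecided win') => //.
(* Prefixes of an undecided position are undecided, so both strategies agree all the way to
   [respond s c]. *)
elim/last_ind: c Nc => // c x IH; rewrite !respond_rcons => Nc.
have Nc' : ~ (cylinder (respond s c) `<=` win_set (Z_of s C)).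
  by move=> sub; apply: Nc => w /cylinder_cat; exact: sub.
by rewrite IH// (winning_undecided win' Nc' (IH Nc')).
Qed.

Lemma esum_Z_of (R : realType) s C :
  (\esum_(p in Z_of s C) (#|A|%:R ^- (size p)./2 : R)%:E =
   \esum_(c in C) (#|A|%:R ^- size c : R)%:E)%R.
Proof.
rewrite /Z_of esum_image; last by move=> c d _ _ /respond_inj2.
by apply: eq_esum => c _; rewrite size_respond doubleK.
Qed.

End Games.

(** Finiteness of [C] matters: over the letters 0 and 1, the words consisting of n zeros and a final
    1 form an infinite maximal prefix code that is not a bar, as it misses the all-zero word. *)
Theorem lemma3p2 (R : realType) (A : finType) (s1 : strategy1 A)
    (C : set (seq A)) :
  (finite_set C /\ maximal_prefix_code C) <->
  (minimal_size R (Z_of s1 C) /\ only_winning s1 (win_set (Z_of s1 C))).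
Proof.
(* The letter [s1 [::]] witnesses that the alphabet is nonempty. *)
by rewrite only_winningP winning_barP /minimal_size esum_Z_of
  (finite_maximal_prefix_codeP R (s1 [::])).
Qed.
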